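(* The bottleneck distance and the erosion distance agree on $\mathsf{PDgm}^0$: for any $Y,Y'\in\mathsf{PDgm}^0$, $$d_B(Y,Y')=d_E(Y,Y').$$
   Context: Let $\mathbb{R}^2_<=\{(b,d)\in\mathbb{R}^2: b<d\}$. A persistence diagram is a finite multiset $Y=\{(b_i,d_i)\}_{i=1}^N$ of points of $\mathbb{R}^2_<$. $\mathsf{PDgm}^0$ is the set of birth-zero persistence diagrams, i.e. those of the form $Y=\{(0,d_i)\}_{i=1}^N$ with $d_1\ge d_2\ge\dots\ge d_N>0$. For $b\le d$, $\mathrm{rank}[Y](b,d)$ is the number (with multiplicity) of $(b_i,d_i)\in Y$ with $b_i\le b\le d<d_i$. The erosion distance $d_E(Y,Y')$ is the infimum of all $\varepsilon\ge0$ such that, for all $b\le d$, $\mathrm{rank}[Y](b-\varepsilon,d+\varepsilon)\le\mathrm{rank}[Y'](b,d)$ and $\mathrm{rank}[Y'](b-\varepsilon,d+\varepsilon)\le\mathrm{rank}[Y](b,d)$. The bottleneck distance is $$d_B(Y,Y')=\min_{\phi:S\to S'}\max\left\{\max_{(b,d)\in S}d_\infty((b,d),\phi(b,d)),\ \max_{(b,d)\in Y\setminus S}\tfrac{d-b}{2},\ \max_{(b',d')\in Y'\setminus S'}\tfrac{d'-b'}{2}\right\},$$ the minimum being over bijections $\phi$ between sub-multisets $S\subseteq Y$ and $S'\subseteq Y'$, with $d_\infty((b,d),(b',d'))=\max\{|b-b'|,|d-d'|\}$ and maxima over empty sets equal to $0$. *)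

(* Defs.v *)
From mathcomp Require Import all_boot all_order all_algebra.
From mathcomp Require Import finmap multiset.
From mathcomp Require Import all_classical all_reals.

Set Implicit Arguments.
Unset Strict Implicit.
Unset Printing Implicit Defensive.

Import Order.TTheory GRing.Theory Num.Theory.

Local Open Scope classical_set_scope.
Local Open Scope mset_scope.
Local Open Scope ring_scope.

Record pdgm (R : realType) := PDgm {
  pdgm_mset :> {mset (R * R)%type};
  pdgm_lt : forall p, p \in pdgm_mset -> p.1 < p.2 }.

Definition pdgm0 (R : realType) : set (pdgm R) :=
  [set Y | exists s : seq R,
     [/\ sorted >=%R s, all (fun d => 0 < d) s
       & pdgm_mset Y = seq_mset [seq (0, d) | d <- s]]].

(* [count] runs over the enumeration of the multiset, in which every point
   is repeated according to its multiplicity. *)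
Definition pd_rank (R : realType) (Y : pdgm R) (b d : R) : nat :=
  count (fun p : R * R => [&& p.1 <= b, b <= d & d < p.2]) Y.

Definition eroded (R : realType) (Y Y' : pdgm R) (e : R) : Prop :=
  forall b d : R, b <= d ->
    (pd_rank Y (b - e) (d + e) <= pd_rank Y' b d)%N /\
    (pd_rank Y' (b - e) (d + e) <= pd_rank Y b d)%N.

Definition erosion_distance (R : realType) (Y Y' : pdgm R) : R :=
  inf [set e : R | 0 <= e /\ eroded Y Y' e].

(* Points of a diagram counted with multiplicity are represented by their
   positions in its enumeration, so that a sub-multiset is a set of positions. *)
Definition pd_idx (R : realType) (Y : pdgm R) := 'I_(size Y).

Definition pd_point (R : realType) (Y : pdgm R) (i : pd_idx Y) : R * R :=
  tnth (in_tuple Y) i.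

(* A bijection phi : S -> S' between sub-multisets is given by its graph M;
   S and S' are the two projections of M. *)
Definition pd_matching (R : realType) (Y Y' : pdgm R)
    (M : {set pd_idx Y * pd_idx Y'}) : bool :=
  `[< {in M &, injective fst} /\ {in M &, injective snd} >].

Definition dinfty (R : realType) (p q : R * R) : R :=
  Num.max `|p.1 - q.1| `|p.2 - q.2|.

Definition half_pers (R : realType) (p : R * R) : R := (p.2 - p.1) / 2.

(* All the terms are nonnegative, so the neutral element 0 of the iterated
   maxima only matters for empty ranges. *)
Definition matching_cost (R : realType) (Y Y' : pdgm R)
    (M : {set pd_idx Y * pd_idx Y'}) : R :=
  Num.max
    (\big[Num.max/0]_(m in M) dinfty (pd_point m.1) (pd_point m.2))
    (Num.max
      (\big[Num.max/0]_(i | i \notin [set m.1 | m in M]%SET)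
         half_pers (pd_point i))
      (\big[Num.max/0]_(j | j \notin [set m.2 | m in M]%SET)
         half_pers (pd_point j))).

(* The minimum is over a finite nonempty set: the empty matching is
   a matching. *)
Definition bottleneck_distance (R : realType) (Y Y' : pdgm R) : R :=
  matching_cost
    [arg min_(M < (finset.set0 : {set pd_idx Y * pd_idx Y'}) | pd_matching M)
       matching_cost M]%O.

(* Main.v *)
Require Import Defs.
From mathcomp Require Import all_boot all_order all_algebra all_reals.
From mathcomp Require Import multiset boolp.
From mathcomp Require Import lra.

(** Both inequalities compare, for a fixed [e], the [e]-erosion condition on
    ranks with the existence of a matching of cost at most [e].

    A matching of cost at most [e] always witnesses erosion by [e], for
    arbitrary diagrams ([eroded_matching_cost]).  A point counted by the rank
    at [(b - e, d + e)] has persistence larger than [2 e], so it cannot be left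
    unmatched, and its partner, which is [e]-close, is counted by the rank of
    the other diagram at [(b, d)]; injectivity of the matching turns this into
    an inequality of ranks.  Hence the erosion distance is at most the cost of
    every matching.

    The converse uses that all births are zero.  Then a diagram is a
    nonincreasing list of death times, say [s] and [s'] extended by zero, and
    the rank at [(b, d)] with [0 <= b <= d] is the number of deaths above [d].
    In terms of the [k]-th largest deaths, erosion by [e] says that
    [2 e < s_k] forces [s_k - e <= s'_k], and symmetrically
    ([eroded_nth_death]).  Matching the [k]-th largest death of one diagram
    with the [k]-th largest of the other, for those [k] where one of the two
    exceeds [2 e], therefore costs at most [e]: matched deaths differ by at most
    [e], and whatever remains has persistence at most [2 e]
    ([eroded_matching]).  So the bottleneck distance is a lower bound of
    the set whose infimum is the erosion distance. *)

Set Implicit Arguments.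
Unset Strict Implicit.
Unset Printing Implicit Defensive.

Import Order.TTheory GRing.Theory Num.Theory.

Local Open Scope ring_scope.

(** Injectivity is asked of [g] only, so a matching can be used with either of
    its projections as [g]. *)
Lemma leq_card_span (T I J : finType) (M : {set T}) (f : T -> I) (g : T -> J)
    (A : {pred I}) (B : {pred J}) :
  {in M &, injective g} ->
  (forall i, i \in A -> exists2 m, m \in M & f m = i /\ g m \in B) ->
  (#|A| <= #|B|)%N.
Proof.
move=> g_inj AB.
pose N := [set m in M | g m \in B].
have cardN : #|g @: N| = #|N|.
  by apply: card_in_imset => m m' /setIdP[mM _] /setIdP[m'M _]; apply: g_inj.
apply: (@leq_trans #|f @: N|).
  apply/subset_leq_card/fintype.subsetP => i /AB[m mM [<- gB]].
  by apply: imset_f; rewrite inE mM.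
apply: leq_trans (leq_imset_card _ _) _; rewrite -cardN.
by apply/subset_leq_card/fintype.subsetP => j /imsetP[m /setIdP[_ ?] ->].
Qed.

Section Distances.
Variable R : realType.
Implicit Types (Y : pdgm R) (s : seq R) (p q : R * R) (b d e t : R).

Lemma pd_rank_card Y b d :
  pd_rank Y b d = #|[pred i : pd_idx Y | [&& (pd_point i).1 <= b, b <= d
                                          & d < (pd_point i).2]]|.
Proof. by rewrite /pd_rank -sum1_count big_tnth sum1_card. Qed.

Lemma dinfty_le p q e :
  (dinfty p q <= e) = (`|p.1 - q.1| <= e) && (`|p.2 - q.2| <= e).
Proof. by rewrite /dinfty ge_max. Qed.

Lemma dinftyC p q : dinfty p q = dinfty q p.
Proof. by rewrite /dinfty (distrC p.1) (distrC p.2). Qed.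

Lemma matching_costP Y Y' (M : {set pd_idx Y * pd_idx Y'}) e :
  matching_cost M <= e <->
  [/\ 0 <= e,
      forall m, m \in M -> dinfty (pd_point m.1) (pd_point m.2) <= e,
      forall i, i \notin [set m.1 | m in M] -> half_pers (pd_point i) <= e
    & forall j, j \notin [set m.2 | m in M] -> half_pers (pd_point j) <= e].
Proof.
rewrite /matching_cost !ge_max; split.
  by case/and3P=> /bigmax_leP[e0 eM] /bigmax_leP[_ eY] /bigmax_leP[_ eY'].
by case=> e0 eM eY eY'; apply/and3P; split; apply/bigmax_leP.
Qed.

(** A point counted on the left has persistence larger than [2 e], hence is
    matched, and its partner within [e] is counted on the right.  The partial
    matching is given by an arbitrary span [f], [g], so that
    exchanging the two projections of a matching gives the inequality of ranks
    in the other direction. *)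
Lemma pd_rank_span Y Y' (T : finType) (M : {set T})
    (f : T -> pd_idx Y) (g : T -> pd_idx Y') e b d :
  {in M &, injective g} ->
  (forall m, m \in M -> dinfty (pd_point (f m)) (pd_point (g m)) <= e) ->
  (forall i, i \notin [set f m | m in M] -> half_pers (pd_point i) <= e) ->
  b <= d ->
  (pd_rank Y (b - e) (d + e) <= pd_rank Y' b d)%N.
Proof.
move=> g_inj eM eY bd; rewrite !pd_rank_card.
apply: (leq_card_span (f := f) g_inj) => i /and3P[ib _ id].
have [/imsetP[m mM im]|/eY] := boolP (i \in [set f m | m in M]); last first.
  by rewrite /half_pers; lra.
exists m => //; split=> //; move: (eM m mM); rewrite -im dinfty_le inE.
by rewrite !ler_norml => /andP[/andP[? ?] /andP[? ?]]; apply/and3P; split; lra.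
Qed.

Lemma eroded_matching_cost Y Y' (M : {set pd_idx Y * pd_idx Y'}) e :
  pd_matching M -> matching_cost M <= e -> eroded Y Y' e.
Proof.
move=> /asboolP[inj1 inj2] /matching_costP[_ eM eY eY'] b d bd; split.
  exact: (pd_rank_span (f := fst) inj2).
apply: (pd_rank_span (f := snd) inj1) => // m mM.
by rewrite dinftyC eM.
Qed.

(** The number of deaths above [t] and the [k]-th largest death determine each
    other; for [t] nonnegative, the default value 0 of [s`_k] past the end of
    [s] acts as a death that is never counted. *)
Lemma ltn_count_gt s t k : sorted >=%R s -> 0 <= t ->
  (k < count (fun d => (t < d)%R) s)%N = (t < s`_k).
Proof.
move=> + t0; elim: s k => [|x s IH] k xs; first by rewrite nth_nil ltNge t0.
have [tx|xt] := ltP t x.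
  by rewrite /= tx; case: k => [//|k]; rewrite add1n ltnS IH // (path_sorted xs).
have le_t : all (fun d => d <= t) (x :: s).
  rewrite /= xt; move: xs; rewrite /= path_sortedE; last exact: rev_trans le_trans.
  by case/andP=> + _; apply: sub_all => y /le_trans; apply.
have -> : count (fun d => t < d) (x :: s) = 0%N.
  apply/eqP; rewrite -leqn0 leqNgt -has_count -all_predC.
  by apply: sub_all le_t => y /=; rewrite leNgt.
rewrite ltn0; apply/esym/negbTE; rewrite -leNgt.
by have [/(all_nthP 0 le_t)|/(nth_default 0)->] := ltnP k (size (x :: s)).
Qed.

(** The enumeration of a multiset comes in no particular order; [r i] is the
    place of the [i]-th point once the deaths are listed in nonincreasing
    order. *)
Definition ranked_deaths Y s (r : pd_idx Y -> nat) : Prop :=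
  [/\ sorted >=%R s, injective r, (forall i, pd_point i = (0, s`_(r i))),
      (forall k, 0 < s`_k -> exists i, r i = k)
    & forall b d, 0 <= b <= d -> pd_rank Y b d = count (fun x => d < x) s].

Lemma ranked_deaths_exist Y : pdgm0 Y -> exists s r, @ranked_deaths Y s r.
Proof.
move=> [s [s_sorted _ Ys]].
have Yperm : perm_eq Y [seq (0, x) | x <- s] by rewrite Ys; apply: perm_eq_seq_mset.
have /(perm_iotaP (0, 0))[r r_perm Yr] := Yperm.
have r_uniq : uniq r by rewrite (perm_uniq r_perm) iota_uniq.
have size_r : size r = size Y by rewrite Yr size_map.
have r_lt i : (i < size r)%N -> (nth 0%N r i < size s)%N.
  by move=> /(mem_nth 0%N); rewrite (perm_mem r_perm) mem_iota size_map.
exists s, (fun i : pd_idx Y => nth 0%N r i); split=> //.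
- move=> i j /eqP; rewrite nth_uniq ?size_r ?ltn_ord // => /eqP; exact: val_inj.
- move=> i; rewrite /pd_point (tnth_nth (0, 0)) /= {1}Yr.
  have ir : (i < size r)%N by rewrite size_r ltn_ord.
  by rewrite (nth_map 0%N) // (nth_map 0) ?r_lt.
- move=> k sk; have ks : (k < size s)%N.
    by case: ltnP sk => // /(nth_default 0)->; rewrite ltxx.
  have kr : k \in r by rewrite (perm_mem r_perm) mem_iota size_map.
  have kY : (index k r < size Y)%N by rewrite -size_r index_mem.
  by exists (Ordinal kY); rewrite /= nth_index.
- move=> b d /andP[b0 bd]; rewrite /pd_rank (permP Yperm) count_map.
  by apply: eq_count => x; rewrite /= b0 bd.
Qed.

Lemma erodedC Y Y' e : eroded Y Y' e -> eroded Y' Y e.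
Proof. by move=> er b d /er[]. Qed.

Lemma eroded_nth_death Y Y' s s' r r' e k :
  @ranked_deaths Y s r -> @ranked_deaths Y' s' r' ->
  0 <= e -> eroded Y Y' e -> 2 * e < s`_k -> s`_k - e <= s'`_k.
Proof.
move=> [s_sorted _ _ _ rkY] [s'_sorted _ _ _ rkY'] e0 er sk.
rewrite leNgt; apply/negP => s'k.
(* The rank at (b - e, t + e) vanishes for b < e, so only thresholds t >= e
   carry information; hence b = e below and the maximum with e here. *)
pose t := Num.max e s'`_k.
have et : e <= t by rewrite le_max lexx.
have s't : s'`_k <= t by rewrite le_max lexx orbT.
have ts : t < s`_k - e by rewrite gt_max; apply/andP; split; lra.
have [le_rk _] := er e t et.
move: le_rk; rewrite rkY ?rkY' ?e0 // ?subrr ?lexx ?addr_ge0 ?(le_trans e0) //.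
move=> le_rk; suff : t < s'`_k by rewrite ltNge s't.
rewrite -ltn_count_gt ?(le_trans e0) //; apply: leq_trans le_rk.
by rewrite ltn_count_gt ?addr_ge0 ?(le_trans e0) //; lra.
Qed.

Lemma eroded_matching Y Y' e : pdgm0 Y -> pdgm0 Y' ->
  0 <= e -> eroded Y Y' e ->
  exists2 M : {set pd_idx Y * pd_idx Y'}, pd_matching M & matching_cost M <= e.
Proof.
move=> /ranked_deaths_exist[s [r Yr]] /ranked_deaths_exist[s' [r' Yr']] e0 er.
have near k := @eroded_nth_death _ _ _ _ _ _ _ k Yr Yr' e0 er.
have near' k := @eroded_nth_death _ _ _ _ _ _ _ k Yr' Yr e0 (erodedC er).
have [_ r_inj ptY rY _] := Yr; have [_ r'_inj ptY' rY' _] := Yr'.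
pose M := [set m : pd_idx Y * pd_idx Y' |
  (r m.1 == r' m.2) && ((2 * e < s`_(r m.1)) || (2 * e < s'`_(r' m.2)))].
exists M.
  apply/asboolP; split=> -[i j] [i' j'] /setIdP[/= /eqP ij _] /setIdP[/= /eqP ij' _].
    by move=> /= ii'; rewrite ii' in ij *; congr pair; apply: r'_inj; rewrite -ij.
  by move=> /= jj'; rewrite jj' in ij *; congr pair; apply: r_inj; rewrite ij.
apply/matching_costP; split=> //.
- move=> [i j] /setIdP[/= /eqP ij big].
  rewrite ptY ptY' dinfty_le /= subrr normr0 e0 /= ij ler_norml.
  rewrite ij in big; move: (near (r' j)) (near' (r' j)).
  (* If only one of the two deaths exceeds 2 e, it is the larger one, and the
     bound coming from it controls the distance. *)
  have [sj|sj] := ltP (2 * e) s`_(r' j).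
    move=> /(_ isT) lo; have [s'j /(_ isT) hi|s'j _] := ltP (2 * e) s'`_(r' j).
      by apply/andP; split; lra.
    by apply/andP; split; lra.
  move: big; rewrite ltNge sj /= => big _ /(_ big) hi.
  by apply/andP; split; lra.
- move=> i iM; rewrite /half_pers ptY /= subr0.
  suff : s`_(r i) <= 2 * e by lra.
  rewrite leNgt; apply: contra iM => big.
  (* The place of i is occupied in the other diagram, as that death exceeds e. *)
  have [|j ji] := rY' (r i); first by move: (near _ big); lra.
  by apply/imsetP; exists (i, j); rewrite // inE /= ji eqxx big.
- move=> j jM; rewrite /half_pers ptY' /= subr0.
  suff : s'`_(r' j) <= 2 * e by lra.
  rewrite leNgt; apply: contra jM => big.
  have [|i ij] := rY (r' j); first by move: (near' _ big); lra.
  by apply/imsetP; exists (i, j); rewrite // inE /= ij eqxx big orbT.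
Qed.

Lemma bottleneck_distanceP Y Y' :
  (exists2 M : {set pd_idx Y * pd_idx Y'},
     pd_matching M & matching_cost M = bottleneck_distance Y Y') /\
  (forall M : {set pd_idx Y * pd_idx Y'},
     pd_matching M -> bottleneck_distance Y Y' <= matching_cost M).
Proof.
rewrite /bottleneck_distance; case: Order.TotalTheory.arg_minP.
  by apply/asboolP; split=> m m'; rewrite inE.
by move=> M M_match M_min; split; first exists M.
Qed.

End Distances.

Theorem theorem4p12 (R : realType) (Y Y' : pdgm R)
    (hY : pdgm0 Y) (hY' : pdgm0 Y') :
  bottleneck_distance Y Y' = erosion_distance Y Y'.
Proof.
have [[M M_match M_cost] dB_min] := bottleneck_distanceP Y Y'.
have dB_ge0 : 0 <= bottleneck_distance Y Y'.
  by have [] := (matching_costP M _).1 (lexx _); rewrite M_cost.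
have dB_eroded : eroded Y Y' (bottleneck_distance Y Y').
  by apply: (eroded_matching_cost M_match); rewrite M_cost.
apply/le_anti/andP; split.
  apply: lb_le_inf; first by exists (bottleneck_distance Y Y').
  move=> e [e0 er]; have [N N_match N_cost] := eroded_matching hY hY' e0 er.
  exact: le_trans (dB_min N N_match) N_cost.
by apply: ge_inf => //; exists 0 => e [].
Qed.
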